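(* Let $\mathcal{X}=(\mathcal{V},\varrho,\upsilon)$ be a complete fuzzy graph with $n=|\varrho^*|$ vertices. Then $$SDI(\mathcal{X})=n\,\varrho(u),$$ where $u$ is a vertex with least weight $\varrho(u)$.
   Context: A fuzzy graph $\mathcal{X}=(\mathcal{V},\varrho,\upsilon)$ consists of a nonempty finite set $\mathcal{V}$ of vertices, a function $\varrho:\mathcal{V}\to[0,1]$ and a symmetric function $\upsilon:\mathcal{V}\times\mathcal{V}\to[0,1]$ with $\upsilon(ab)\le\min(\varrho(a),\varrho(b))$ for all $a,b$, and no loops ($\upsilon(aa)=0$). Put $\varrho^*=\{a:\varrho(a)>0\}$ and $\upsilon^*=\{ab:\upsilon(ab)>0\}$; it is assumed that $\mathcal{V}=\varrho^*$, and the elements of $\upsilon^*$ are called edges. $\mathcal{X}$ is a complete fuzzy graph if $\upsilon(ab)=\min(\varrho(a),\varrho(b))$ for all distinct $a,b\in\varrho^*$. A path is a sequence of distinct vertices $a_1,\dots,a_m$ with $\upsilon(a_ia_{i+1})>0$ for all $i<m$; its strength is the minimum of the weights $\upsilon$ of its edges. The strength of connectedness between $a$ and $b$ is the maximum of the strengths of all paths from $a$ to $b$ (and $0$ if there is none). An edge $ab$ is strong if $\upsilon(ab)$ is at least the strength of connectedness between $a$ and $b$ in the fuzzy graph obtained by deleting the edge $ab$. A set $\mathcal{D}\subseteq\mathcal{V}$ is a strong dominating set (SDS) if every $b\in\mathcal{V}\setminus\mathcal{D}$ is joined by a strong edge to some $a\in\mathcal{D}$. An SDS $\mathcal{D}$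 is a minimal strong dominating set (MSDS) if $\mathcal{D}\setminus\{a\}$ is not an SDS for every $a\in\mathcal{D}$. The weight of $\mathcal{S}\subseteq\mathcal{V}$ is $W(\mathcal{S})=\sum_{a\in\mathcal{S}}\min\{\upsilon(ab): ab \text{ is a strong edge}\}$; whenever weights are used it is understood that every vertex is incident with at least one strong edge (so here $n\ge2$). The strong domination degree ${}_{sd}d(u)$ of a vertex $u$ is the minimum of the weights of the MSDSs containing $u$; the strong domination index is $SDI(\mathcal{X})=\sum_{v\in\mathcal{V}}{}_{sd}d(v)$. *)

(* Defs.v *)
From HB Require Import structures.
From mathcomp Require Import all_boot all_order all_algebra.
Set Implicit Arguments.
Unset Strict Implicit.
Unset Printing Implicit Defensive.
Import Order.TTheory GRing.Theory Num.Theory.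
Local Open Scope ring_scope.

Record fuzzyGraph (R : realFieldType) (V : finType) := FuzzyGraph {
  vwt : V -> R;
  ewt : V -> V -> R;
  V_nonempty : (0 < #|V|)%N;
  vwt_itv : forall a, 0 <= vwt a <= 1;
  ewt_itv : forall a b, 0 <= ewt a b <= 1;
  ewt_sym : forall a b, ewt a b = ewt b a;
  ewt_min : forall a b, ewt a b <= Num.min (vwt a) (vwt b);
  ewt_loopless : forall a, ewt a a = 0
}.

(* Minimum of a nonempty list; the value 0 on the empty list is a dummy. *)
Definition minlist (R : realFieldType) (s : seq R) : R :=
  if s is x :: s' then \big[Num.min/x]_(y <- s') y else 0.

Section FuzzyGraphTheory.
Variables (R : realFieldType) (V : finType).
Implicit Types (X : fuzzyGraph R V) (D S : {set V}) (a b u v : V).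

Definition vsupport X : {set V} := [set a | 0 < vwt X a].

Definition complete_fuzzy X : Prop :=
  forall a b, a \in vsupport X -> b \in vsupport X -> a != b ->
    ewt X a b = Num.min (vwt X a) (vwt X b).

(* The path with vertices a :: p, ending at b. *)
Definition is_path X a b (p : seq V) : bool :=
  [&& path (fun x y => 0 < ewt X x y) a p, uniq (a :: p) & last a p == b].

(* [pairmap] lists the weights of the consecutive edges of a :: p. *)
Definition strength X a (p : seq V) : R := minlist (pairmap (ewt X) a p).

(* Since a :: p is duplicate-free, p has fewer than #|V| elements, so the
   double maximum ranges over all paths from a to b; strengths are
   nonnegative, so 0 is the value exactly when there is no contribution. *)
Definition connectedness X a b : R :=
  \big[Num.max/0]_(m < #|V|)
    \big[Num.max/0]_(p : m.-tuple V | is_path X a b p) strength X a p.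

Definition del_ewt X a b x y : R :=
  if [set x; y] == [set a; b] then 0 else ewt X x y.

Fact del_ewt_itv X a b x y : 0 <= del_ewt X a b x y <= 1.
Proof.
by rewrite /del_ewt; case: ifP => _; [rewrite lexx ler01 | exact: ewt_itv].
Qed.

Fact del_ewt_sym X a b x y : del_ewt X a b x y = del_ewt X a b y x.
Proof. by rewrite /del_ewt setUC ewt_sym. Qed.

Fact del_ewt_min X a b x y :
  del_ewt X a b x y <= Num.min (vwt X x) (vwt X y).
Proof.
rewrite /del_ewt; case: ifP => _; last exact: ewt_min.
by rewrite le_min; case/andP: (vwt_itv X x) (vwt_itv X y) => -> _ /andP[-> _].
Qed.

Fact del_ewt_loopless X a b x : del_ewt X a b x x = 0.
Proof. by rewrite /del_ewt ewt_loopless if_same. Qed.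

Definition del_edge X a b : fuzzyGraph R V :=
  FuzzyGraph (V_nonempty X) (vwt_itv X) (del_ewt_itv X a b)
    (del_ewt_sym X a b) (del_ewt_min X a b) (del_ewt_loopless X a b).

Definition strong_edge X a b : bool :=
  (0 < ewt X a b) && (connectedness (del_edge X a b) a b <= ewt X a b).

Definition sds X D : bool :=
  [forall b in ~: D, exists a in D, strong_edge X a b].

Definition msds X D : bool :=
  sds X D && [forall a in D, ~~ sds X (D :\ a)].

Definition weight X S : R :=
  \sum_(a in S) minlist [seq ewt X a b | b in [set b | strong_edge X a b]].

Definition sdd X u : R :=
  minlist [seq weight X D | D in [set D : {set V} | msds X D & u \in D]].

Definition sdi X : R := \sum_v sdd X v.

End FuzzyGraphTheory.

(* Main.v *)
(** In a complete fuzzy graph every pair of distinct vertices is a strong edge: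
    a path from [a] to [b] uses an edge at [a] and an edge at [b], so its
    strength is at most [min (vwt a) (vwt b)], the weight of the edge itself.
    Hence the minimal strong dominating sets are the singletons, and the
    lightest strong edge at any vertex has weight [vwt u]. *)

Require Import Defs.
From mathcomp Require Import all_boot all_order all_algebra.
Import Order.TTheory GRing.Theory Num.Theory.
Local Open Scope ring_scope.

Lemma minlist_le (R : realFieldType) (s : seq R) (x : R) :
  x \in s -> minlist s <= x.
Proof.
case: s => [//|y s] /=; elim: s => [|z s IHs]; rewrite ?big_nil ?big_cons.
  by rewrite inE => /eqP->.
rewrite !inE orbCA ge_min => /orP[/eqP->|xs]; first by rewrite lexx.
by rewrite IHs ?orbT.
Qed.

(** The membership [x \in s] excludes the empty list, so the dummy value 0 of [minlist] never enters
    the later computations. *)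
Lemma minlist_eq (R : realFieldType) (s : seq R) (x : R) :
  x \in s -> {in s, forall y, x <= y} -> minlist s = x.
Proof.
move=> xs x_min; apply/le_anti; rewrite minlist_le //=.
case: s xs x_min => [//|y s] _ x_min /=.
rewrite big_seq; elim/big_ind: _ => [|z t xz xt|z zs].
- by rewrite x_min ?mem_head.
- by rewrite le_min xz.
- by rewrite x_min ?inE ?zs ?orbT.
Qed.

Lemma strength_le_min (R : realFieldType) (V : finType) (X : fuzzyGraph R V)
    (a b : V) (p : seq V) :
  a != b -> last a p = b -> strength X a p <= Num.min (vwt X a) (vwt X b).
Proof.
move=> ab lastp; rewrite /strength le_min; apply/andP; split.
  case: p lastp => [/eqP|x p _] /=; first by rewrite (negPf ab).
  apply: le_trans (minlist_le _ _ _ (mem_head _ _)) _.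
  by apply: le_trans (ewt_min X a x) _; rewrite ge_min lexx.
(* For the bound by [vwt X b] the path is split at its right end, which exposes the edge entering
   [b]. *)
case/lastP: p lastp => [/eqP|p x]; first by rewrite (negPf ab).
rewrite last_rcons -cats1 pairmap_cat => -> /=.
apply: (@le_trans _ _ (ewt X (last a p) b)).
  by apply: minlist_le; rewrite mem_cat mem_head orbT.
by apply: le_trans (ewt_min X _ b) _; rewrite ge_min lexx orbT.
Qed.

(** Completeness is not assumed, so that the bound applies to [del_edge X a b], which is no longer
    complete but has the same vertex weights as [X]. *)
Lemma connectedness_le_min (R : realFieldType) (V : finType)
    (X : fuzzyGraph R V) (a b : V) :
  a != b -> connectedness X a b <= Num.min (vwt X a) (vwt X b).
Proof.
(* Both maxima start from 0, so 0 itself must lie below the bound. *)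
move=> ab; have min_ge0 : 0 <= Num.min (vwt X a) (vwt X b).
  by apply: le_trans (ewt_min X a b); case/andP: (ewt_itv X a b).
apply/bigmax_leP; split=> // m _; apply/bigmax_leP; split=> // p /and3P[_ _].
by move/eqP; apply: strength_le_min.
Qed.

Section CompleteFuzzyGraph.
Variables (R : realFieldType) (V : finType) (X : fuzzyGraph R V).
Hypothesis support_full : vsupport X = [set: V].
Hypothesis X_complete : complete_fuzzy X.

Lemma complete_ewt (a b : V) :
  a != b -> ewt X a b = Num.min (vwt X a) (vwt X b).
Proof. by apply: X_complete; rewrite support_full inE. Qed.

Lemma complete_strong_edge (a b : V) : strong_edge X a b = (a != b).
Proof.
rewrite /strong_edge; have [->|ab] := eqVneq a b.
  by rewrite ewt_loopless ltxx.
have vwt_gt0 v : 0 < vwt X v.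
  by have := in_setT v; rewrite -support_full inE.
rewrite complete_ewt // lt_min !vwt_gt0.
exact: (connectedness_le_min _ _ (del_edge X a b)).
Qed.

Lemma complete_sds (D : {set V}) : sds X D = (D != set0).
Proof.
apply/idP/set0Pn => [/forallP dom|[a aD]].
  (* Any vertex [v] shows that [D] is nonempty: it lies in [D] or is dominated by a member of
     [D]. *)
  have /card_gt0P[v _] := V_nonempty X.
  have := dom v; rewrite inE; case: (boolP (v \in D)) => [vD _|_ /=].
    by exists v.
  by case/existsP=> a /andP[aD _]; exists a.
apply/forallP => b; rewrite inE; apply/implyP => bD; apply/existsP; exists a.
by rewrite aD complete_strong_edge; apply: contraNneq bD => <-.
Qed.

(** Once [v] is removed, a minimal [D] no longer dominates, hence is empty by [complete_sds]. The
    conjunction has the form of the filter in [sdd], which therefore selects only [[set v]]. *)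
Lemma complete_msds (D : {set V}) (v : V) :
  msds X D && (v \in D) = (D == [set v]).
Proof.
apply/andP/eqP => [[/andP[_ /forallP D_min] vD]|->].
  have := D_min v; rewrite vD complete_sds negbK setD_eq0 subset1.
  by case/orP=> /eqP // D0; rewrite D0 inE in vD.
rewrite set11 /msds complete_sds; split=> //; apply/andP; split.
  by apply/set0Pn; exists v; rewrite set11.
apply/forallP => a; apply/implyP => /set1P->.
by rewrite complete_sds setDv eqxx.
Qed.

Lemma complete_sdd (v : V) : sdd X v = weight X [set v].
Proof.
apply: minlist_eq => [|w /imageP[D]].
  by apply/imageP; exists [set v] => //; rewrite inE complete_msds.
by rewrite inE complete_msds => /eqP-> ->.
Qed.

Lemma complete_weight1 (u v : V) :
  (1 < #|V|)%N -> (forall w, vwt X u <= vwt X w) ->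
  weight X [set v] = vwt X u.
Proof.
move=> V_gt1 u_least; rewrite /weight big_set1; apply: minlist_eq.
  have [b vb min_vb] : exists2 b, v != b & Num.min (vwt X v) (vwt X b) = vwt X u.
    (* The edge from [v] to [u] attains the minimum when [v != u]. At [u] itself every edge does,
       and [1 < #|V|] supplies a second endpoint. *)
    have [->|vu] := eqVneq v u; last by exists u => //; apply/min_idPr.
    have /card_gt0P[b] : (0 < #|predC1 u|)%N.
      by rewrite cardC1 -ltnS prednK // ltnW.
    rewrite !inE eq_sym => ub; exists b => //; exact/min_idPl.
  by apply/imageP; exists b; rewrite ?inE ?complete_strong_edge ?complete_ewt.
move=> w /imageP[b]; rewrite inE complete_strong_edge => vb ->.
by rewrite complete_ewt // le_min !u_least.
Qed.

End CompleteFuzzyGraph.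

Theorem theorem4p5 (R : realFieldType) (V : finType) (X : fuzzyGraph R V)
    (n : nat) (u : V)
    (support_full : vsupport X = [set: V])
    (n_card : n = #|vsupport X|)
    (n_ge2 : (2 <= n)%N)
    (X_complete : complete_fuzzy X)
    (u_least : forall v : V, vwt X u <= vwt X v) :
  sdi X = n%:R * vwt X u.
Proof.
have nV : n = #|V| by rewrite n_card support_full cardsT.
rewrite /sdi (eq_bigr (fun=> vwt X u)) => [|v _].
  by rewrite sumr_const -nV mulr_natl.
by rewrite complete_sdd // (complete_weight1 _ _ _ _ _ u) // -nV.
Qed.
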